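(* Let $Q$ be a finite quiver with $k$ vertices, $\theta\in\mathbb{Z}^{k}$ a stability structure, $\{\gamma_1,\dots,\gamma_l\}$ the minimal set of generators of the monoid $V_\theta$, and $Q_\theta$ the associated controlling quiver. Then $Q_\theta$ determines the local quiver setting $(Q_M,\alpha_M)$ describing the étale local structure of the moduli space $\mathrm{mod}^{ss}_\alpha(Q,\theta)$ near the point corresponding to $$M=S_1^{\oplus e_1}\oplus\cdots\oplus S_u^{\oplus e_u},$$ where the $S_i$ are pairwise non-isomorphic $\theta$-stable representations of dimension vectors $\beta_i$ (so $\alpha=\sum_i e_i\beta_i$). More precisely: if $N$ and $N'$ are $\theta$-stable representations of $Q$ of dimension vectors $\beta$ and $\beta'$, and if $\beta=\sum_{i=1}^l c_i\gamma_i$ and $\beta'=\sum_{i=1}^l c_i'\gamma_i$ with $\gamma=(c_1,\dots,c_l)$ and $\gamma'=(c_1',\dots,c_l')$ dimension vectors of simple representations of $Q_\theta$, then $$\chi_Q(\beta,\beta')=\chi_{Q_\theta}(\gamma,\gamma').$$ (Thus, if $\beta_i=\sum_j c_{ij}\gamma_j$ with each $\gamma^{(i)}=(c_{i1},\dots,c_{il})$ the dimension vector of a simple representation of $Q_\theta$, the number of arrows from vertex $i$ to vertex $j$ in $Q_M$ is $\delta_{ij}-\chi_{Q_\theta}(\gamma^{(i)},\gamma^{(j)})$.)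
   Context: All quivers are finite (loops and oriented cycles allowed) and all representations are finite dimensional over $\mathbb{C}$. The Ringel form of a quiver $Q$ with vertices $1,\dots,k$ is the bilinear form on $\mathbb{Z}^k$ with $\chi_Q(\epsilon_i,\epsilon_j)=\delta_{ij}-\#\{\text{arrows from } i \text{ to } j\}$, where $\epsilon_i$ is the $i$-th standard basis vector. For $\theta\in\mathbb{Z}^k$, a representation $V$ of $Q$ of dimension vector $\alpha$ is $\theta$-semistable if $\theta\cdot\alpha=\sum_i\theta_i a_i=0$ and $\theta\cdot\beta_W\ge 0$ for every proper nonzero subrepresentation $W\subset V$ of dimension vector $\beta_W$; it is $\theta$-stable if moreover all these inequalities are strict. $\mathrm{mod}^{ss}_\alpha(Q,\theta)$ is the moduli space of $\theta$-semistable representations of dimension vector $\alpha$ (King); its points correspond to isomorphism classes of direct sums $M=S_1^{\oplus e_1}\oplus\cdots\oplus S_u^{\oplus e_u}$ of $\theta$-stable representations $S_i$ with $\sum_i e_i\dim S_i=\alpha$. Local quiver setting $(Q_M,\alpha_M)$: for such $M$ with distinct stable factors $S_i$ of dimension vectors $\beta_i$, $Q_M$ has $u$ vertices, the number of arrows (loops if $i=j$) from vertex $i$ to vertex $j$ is $\delta_{ij}-\chi_Q(\beta_i,\beta_j)$, and $\alpha_M=(e_1,\dots,e_u)$. (A neighbourhood of $M$ in $\mathrm{mod}^{ss}_\alpha(Q,\theta)$ is étale isomorphic to a neighbourhood of $\overline 0$ in $\mathrm{rep}_{\alpha_M}(Q_M)/GL(\alpha_M)$, where $\mathrm{rep}_{\alpha_M}(Q_M)$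 is the affine space of representations of dimension vector $\alpha_M$, $GL(\alpha_M)=\prod_i GL_{e_i}$ acts by base change, and $/$ denotes the affine GIT quotient.) $V_\theta\subset\mathbb{N}^k$ is the additive monoid of all dimension vectors $\alpha$ with $\theta\cdot\alpha=0$ for which there exists a $\theta$-semistable representation of $Q$ of dimension vector $\alpha$; $\{\gamma_1,\dots,\gamma_l\}$ denotes its minimal set of additive monoid generators. The controlling quiver $Q_\theta$ has vertices $1,\dots,l$, and the number of arrows (loops if $i=j$) from $i$ to $j$ is $\delta_{ij}-\chi_Q(\gamma_i,\gamma_j)$. *)

(* Defs.v *)
From HB Require Import structures.
From mathcomp Require Import all_boot all_order all_algebra.
From mathcomp Require Import boolp classical_sets.

Set Implicit Arguments.
Unset Strict Implicit.
Unset Printing Implicit Defensive.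

Import GRing.Theory Num.Theory.
Local Open Scope ring_scope.
Local Open Scope classical_set_scope.

Record quiver (k : nat) := Quiver {
  arrow : finType;
  src : arrow -> 'I_k;
  tgt : arrow -> 'I_k
}.

Definition narrows k (Q : quiver k) (i j : 'I_k) : nat :=
  #|[set a : arrow Q | (src a == i) && (tgt a == j)]%SET|.

Definition quiver_of_counts k (n : 'I_k -> 'I_k -> nat) : quiver k :=
  @Quiver k {ij : 'I_k * 'I_k & 'I_(n ij.1 ij.2)}
    (fun a => (tag a).1) (fun a => (tag a).2).

Lemma narrows_quiver_of_counts k (n : 'I_k -> 'I_k -> nat) i j :
  narrows (quiver_of_counts n) i j = n i j.
Proof.
rewrite /narrows -[RHS]card_ord.
pose f (x : 'I_(n i j)) : arrow (quiver_of_counts n) :=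
  @Tagged _ (i, j) (fun ij : 'I_k * 'I_k => 'I_(n ij.1 ij.2)) x.
have f_inj : injective f by move=> x y /eqP; rewrite eq_Tagged => /eqP.
rewrite -(card_imset _ f_inj); apply: eq_card => a; rewrite inE.
apply/idP/imsetP => [|[x _ ->]]; last by rewrite /= !eqxx.
case: a => [[i' j'] x] /= /andP[/eqP ei /eqP ej].
by subst i' j'; exists x.
Qed.

Definition ringel_mx k (Q : quiver k) : 'M[int]_k :=
  \matrix_(i, j) ((i == j)%:R - (narrows Q i j)%:R).

Definition ringel k (Q : quiver k) (x y : 'rV[int]_k) : int :=
  (x *m ringel_mx Q *m y^T) 0 0.

(* The integer [(i == j)%:R - ringel Q (b i) (b j)] need not be nonnegative for
   an arbitrary family b; [absz] returns it unchanged when it is. *)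
Definition ext_quiver k (Q : quiver k) m (b : 'I_m -> 'rV[int]_k) : quiver m :=
  quiver_of_counts (fun i j => `|(i == j)%:R - ringel Q (b i) (b j)|%N).

Record rep (F : fieldType) k (Q : quiver k) := Rep {
  space :> 'I_k -> vectType F;
  rmap : forall a : arrow Q, 'Hom(space (src a), space (tgt a))
}.

Section Representations.
Variables (F : fieldType) (k : nat) (Q : quiver k).
Implicit Types (V : rep F Q) (theta : 'rV[int]_k).

Definition dimvec V : 'rV[int]_k := \row_i (\dim {: V i})%:R.

Definition subrep V (W : forall i, {vspace V i}) : Prop :=
  forall a : arrow Q, (rmap V a @: W (src a) <= W (tgt a))%VS.

Definition proper_nonzero V (W : forall i, {vspace V i}) : Prop :=
  (exists i, W i != 0%VS) /\ (exists i, W i != fullv).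

Definition sub_dimvec V (W : forall i, {vspace V i}) : 'rV[int]_k :=
  \row_i (\dim (W i))%:R.

Definition rep_nonzero V : Prop := exists i, {: V i}%VS != 0%VS.

Definition rep_iso V V' : Prop :=
  exists f : forall i, 'Hom(V i, V' i),
    (forall i, bijective (f i)) /\
    (forall (a : arrow Q) (v : V (src a)),
       f (tgt a) (rmap V a v) = rmap V' a (f (src a) v)).

Definition simple_rep V : Prop :=
  rep_nonzero V /\ forall W, subrep W -> ~ @proper_nonzero V W.

Definition weight theta (x : 'rV[int]_k) : int := \sum_i theta 0 i * x 0 i.

Definition semistable theta V : Prop :=
  weight theta (dimvec V) = 0 /\
  forall W, subrep W -> @proper_nonzero V W -> 0 <= weight theta (sub_dimvec W).

(* As usual, the zero representation is semistable but not stable. *)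
Definition stable theta V : Prop :=
  [/\ rep_nonzero V, weight theta (dimvec V) = 0 &
      forall W, subrep W -> @proper_nonzero V W ->
        0 < weight theta (sub_dimvec W)].

Definition simple_dimvec (c : 'rV[int]_k) : Prop :=
  exists V, simple_rep V /\ dimvec V = c.

Definition semistable_dimvec theta : set 'rV[int]_k :=
  [set alpha | exists V, semistable theta V /\ dimvec V = alpha].

(* A point of the moduli space of semistable representations of dimension
   vector alpha, given as the direct sum of the [factor i] with multiplicities
   [mult i]. *)
Record moduli_point theta (alpha : 'rV[int]_k) := ModuliPoint {
  nfactors : nat;
  factor : 'I_nfactors -> rep F Q;
  mult : 'I_nfactors -> nat;
  factor_stable : forall i, stable theta (factor i);
  factor_noniso : forall i j, rep_iso (factor i) (factor j) -> i = j;
  mult_gt0 : forall i, (0 < mult i)%N;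
  moduli_point_dimvec : \sum_i dimvec (factor i) *+ mult i = alpha
}.

Definition mult_dimvec theta alpha (M : moduli_point theta alpha) :
    'rV[int]_(nfactors M) := \row_i (mult i)%:R.

Definition local_quiver theta alpha (M : moduli_point theta alpha) :
    quiver (nfactors M) :=
  ext_quiver Q (fun i : 'I_(nfactors M) => dimvec (factor i)).

Definition local_setting theta alpha (M : moduli_point theta alpha) :
    quiver (nfactors M) * 'rV[int]_(nfactors M) :=
  (local_quiver M, mult_dimvec M).

End Representations.

Definition monoid_span k (S : set 'rV[int]_k) : set 'rV[int]_k :=
  [set x | exists s : seq 'rV[int]_k,
     (forall v, v \in s -> S v) /\ x = \sum_(v <- s) v].

Definition minimal_generators k (A S : set 'rV[int]_k) : Prop :=
  monoid_span S = A /\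
  forall S', S' `<=` S -> monoid_span S' = A -> S' = S.

(* Main.v *)
(* Each minimal generator of the monoid of semistable dimension vectors is
   indecomposable in it, so a semistable representation of that dimension has
   no proper nonzero subrepresentation W of weight 0 (both W and the quotient
   would be semistable): it is stable.  For stable V and W, Schur's lemma bounds
   dim Hom(V, W) by 1 if V = W and by 0 if they are not isomorphic, and
   chi(dim V, dim W) <= dim Hom(V, W) because Hom(V, W) is the kernel of a map
   from the sum of the Hom(V_i, W_i) to the sum over the arrows a of the
   Hom(V_(src a), W_(tgt a)).  Hence the arrow counts delta_ij - chi are
   nonnegative, for the controlling quiver and for the local quivers, and the
   identities follow by bilinearity of the Ringel form. *)
Require Import Defs.
From HB Require Import structures.
From mathcomp Require Import all_boot all_order all_algebra.
From mathcomp Require Import boolp classical_sets reals.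
From mathcomp Require Import complex.

Set Implicit Arguments.
Unset Strict Implicit.
Unset Printing Implicit Defensive.

Import Order.TTheory GRing.Theory Num.Theory.
Import VectorInternalTheory.
Local Open Scope ring_scope.
Local Open Scope classical_set_scope.


(** * The Ringel form as a bilinear form *)

Lemma ringelE k (Q : quiver k) (x y : 'rV[int]_k) :
  ringel Q x y =
    \sum_i x 0 i * y 0 i - \sum_(a : arrow Q) x 0 (src a) * y 0 (tgt a).
Proof.
have countE i j : (narrows Q i j)%:R =
    \sum_(a : arrow Q) ((src a == i) && (tgt a == j))%:R :> int.
  rewrite -natr_sum; congr (_%:R); rewrite /narrows -sum1_card big_mkcond /=.
  by apply: eq_bigr => a _; rewrite inE; case: (_ && _).
have arrowE (a : arrow Q) : x 0 (src a) * y 0 (tgt a) =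
    \sum_j \sum_i x 0 i * ((src a == i) && (tgt a == j))%:R * y 0 j.
  rewrite (bigD1 (tgt a)) //= (bigD1 (src a)) //= !eqxx /= mulr1.
  rewrite !big1 ?addr0 // => [j /negPf ja|i /negPf ia].
    by rewrite big1 // => i _; rewrite [tgt a == j]eq_sym ja andbF mulr0 mul0r.
  by rewrite [src a == i]eq_sym ia mulr0 mul0r.
rewrite (eq_bigr _ (fun a _ => arrowE a)) exchange_big /= -sumrB /ringel mxE.
apply: eq_bigr => j _; rewrite exchange_big /= !mxE mulr_suml.
have -> : x 0 j * y 0 j = \sum_i x 0 i * (i == j)%:R * y 0 j.
  rewrite (bigD1 j) //= eqxx mulr1 big1 ?addr0 // => i /negPf ->.
  by rewrite mulr0 mul0r.
rewrite -sumrB; apply: eq_bigr => i _.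
by rewrite mxE countE -mulr_suml -mulr_sumr mulrBr mulrBl.
Qed.

Lemma ringel_suml k (Q : quiver k) I (r : seq I) (P : pred I)
    (u : I -> 'rV[int]_k) y :
  ringel Q (\sum_(i <- r | P i) u i) y = \sum_(i <- r | P i) ringel Q (u i) y.
Proof. by rewrite /ringel !mulmx_suml summxE. Qed.

Lemma ringel_sumr k (Q : quiver k) I (r : seq I) (P : pred I)
    (u : I -> 'rV[int]_k) x :
  ringel Q x (\sum_(i <- r | P i) u i) = \sum_(i <- r | P i) ringel Q x (u i).
Proof. by rewrite /ringel raddf_sum mulmx_sumr summxE. Qed.

Lemma ringelZ k (Q : quiver k) a b (x y : 'rV[int]_k) :
  ringel Q (a *: x) (b *: y) = a * ringel Q x y * b.
Proof. by rewrite /ringel linearZ /= -scalemxAr -!scalemxAl !mxE mulrC. Qed.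

(** Nonnegativity makes the [absz] in [ext_quiver] harmless, so the Ringel matrix of the new quiver
    is the Gram matrix of the family [b]; bilinearity does the rest. *)
Lemma ringel_ext_quiver k (Q : quiver k) m (b : 'I_m -> 'rV[int]_k) :
    (forall i j, 0 <= (i == j)%:R - ringel Q (b i) (b j)) ->
  forall c c' : 'rV[int]_m,
  ringel (ext_quiver Q b) c c' =
    ringel Q (\sum_i c 0 i *: b i) (\sum_i c' 0 i *: b i).
Proof.
move=> b_ge0 c c'; rewrite ringel_sumr {1}/ringel mxE; apply: eq_bigr => j _.
rewrite ringel_suml !mxE mulr_suml; apply: eq_bigr => i _.
by rewrite ringelZ mxE narrows_quiver_of_counts (natz `|_|%N) gez0_abs // subKr.
Qed.

(* The linear map phi goes between direct sums, written as dependent functions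
   because these carry no vectType structure. *)
Section LinearFamilies.
Variables (F : fieldType) (I J : finType).
Variables (U : I -> vectType F) (T : J -> vectType F).
Variable phi : (forall i, U i) -> forall j, T j.
Hypothesis phi_ext : forall f g,
  (forall i, f i = g i) -> forall j, phi f j = phi g j.
Hypothesis phi_linear : forall a f g j,
  phi (fun i => a *: f i + g i) j = a *: phi f j + phi g j.

(** Rank-nullity in coordinates: the kernel lies in the span of [m] vectors and the image lies in
    the target. *)
Lemma kernel_dim_bound m (g : 'I_m -> forall i, U i) :
    (forall f, (forall j, phi f j = 0) ->
       exists a : 'I_m -> F, forall i, f i = \sum_s a s *: g s i) ->
  (\sum_i \dim {: U i} <= \sum_j \dim {: T j} + m)%N.
Proof.
move=> g_span.
(* The direct sums are modelled by coordinate functions on pairs of an index and a basis position,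
   which do form vector spaces. *)
pose X := {ffun {i : I & 'I_(dim (U i))} -> F^o}.
pose Y := {ffun {j : J & 'I_(dim (T j))} -> F^o}.
pose dec (x : X) i : U i := r2v (\row_p x (Tagged (fun i => 'I_(dim (U i))) p)).
pose enc (f : forall i, U i) : X := [ffun t => v2r (f (tag t)) 0 (tagged t)].
have decK x : enc (dec x) = x.
  by apply/ffunP => -[i p]; rewrite ffunE /= r2vK mxE.
have dec_linear a x y i : dec (a *: x + y) i = a *: dec x i + dec y i.
  by rewrite -linearP; congr r2v; apply/rowP => p; rewrite !mxE !ffunE.
pose Phi (x : X) : Y := [ffun t => v2r (phi (dec x) (tag t)) 0 (tagged t)].
have Phi_linear : linear Phi.
  move=> a x y; apply/ffunP => t; rewrite !ffunE.
  by rewrite (phi_ext (dec_linear a x y)) phi_linear linearP !mxE.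
pose lPhi := GRing.isLinear.Build F X Y _ Phi Phi_linear.
pose Phil : {linear X -> Y} := HB.pack Phi lPhi.
pose K := lker (linfun Phil).
have K_span : (K <= <<[seq enc (g s) | s <- enum 'I_m]>>)%VS.
  apply/subvP => x; rewrite memv_ker lfunE /= => /eqP Phi0.
  have [j|a a_span] := g_span (dec x).
    apply: v2r_inj; rewrite linear0; apply/rowP => q.
    have /ffunP/(_ (Tagged (fun j => 'I_(dim (T j))) q)) := Phi0.
    by rewrite !ffunE mxE.
  have -> : x = \sum_s a s *: enc (g s).
    apply/ffunP => t; rewrite -[in LHS](decK x) ffunE a_span linear_sum summxE.
    by rewrite sum_ffunE; apply: eq_bigr => s _; rewrite linearZ !mxE !ffunE.
  by apply: memv_suml => s _; apply/memvZ/memv_span/map_f; rewrite mem_enum.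
have sumE (A : finType) (S : A -> vectType F) :
    dim {ffun {i : A & 'I_(dim (S i))} -> F^o} = (\sum_i \dim {: S i})%N.
  rewrite (_ : dim _ = #|{: {i : A & 'I_(dim (S i))}}| * 1)%N // muln1.
  rewrite card_tagged sumnE big_map big_enum /=.
  by apply: eq_bigr => i _; rewrite card_ord dimvf.
have dimK : (\dim K <= m)%N.
  rewrite (leq_trans (dimvS K_span)) // (leq_trans (dim_span _)) //.
  by rewrite size_map size_enum_ord.
rewrite -!sumE -/X -/Y -!dimvf -(limg_ker_dim (linfun Phil) fullv) capfv addnC.
by apply: leq_add => //; rewrite dimvS ?subvf.
Qed.

End LinearFamilies.

(** * Homomorphisms, Schur's lemma, subrepresentations and quotients *)

Section Reps.
Variables (F : fieldType) (k : nat) (Q : quiver k).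
Implicit Types (V W : rep F Q) (theta : 'rV[int]_k).

Definition rep_hom V W (f : forall i, 'Hom(V i, W i)) : Prop :=
  forall a v, f (tgt a) (rmap V a v) = rmap W a (f (src a) v).

(** Homomorphisms form the kernel of [phi] below, and by [ringelE] the form is the dimension of the
    source of [phi] minus that of its target. *)
Lemma ringel_le_dim_hom V W m (g : 'I_m -> forall i, 'Hom(V i, W i)) :
    (forall f, rep_hom f ->
       exists a : 'I_m -> F, forall i, f i = \sum_s a s *: g s i) ->
  ringel Q (dimvec V) (dimvec W) <= m%:R.
Proof.
move=> g_span.
pose phi (f : forall i, 'Hom(V i, W i)) a : 'Hom(V (src a), W (tgt a)) :=
  ((f (tgt a) \o rmap V a) - (rmap W a \o f (src a)))%VF.
have phi_ext f g' : (forall i, f i = g' i) -> forall a, phi f a = phi g' a.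
  by move=> eq_fg a; rewrite /phi !eq_fg.
have phi_linear c f g' a :
    phi (fun i => c *: f i + g' i) a = c *: phi f a + phi g' a.
  apply/lfunP => v; do ![rewrite !lfunE /=]; rewrite linearP scalerBr.
  by rewrite opprD addrACA.
have /= := kernel_dim_bound phi_ext phi_linear (g := g).
rewrite ringelE lerBlDr => dim_le.
have dim_hom i j : \dim {: 'Hom(V i, W j)} = (\dim {: V i} * \dim {: W j})%N.
  by rewrite !dimvf.
under eq_bigr do rewrite !mxE -natrM -dim_hom.
under [in leRHS]eq_bigr do rewrite !mxE -natrM -dim_hom.
rewrite -!natr_sum -natrD ler_nat addnC dim_le // => f phi_f.
apply: g_span => a v; apply/eqP; rewrite -subr_eq0; apply/eqP.
by have /lfunP/(_ v) := phi_f a; do ![rewrite !lfunE /=].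
Qed.

Lemma weightD theta x y : weight theta (x + y) = weight theta x + weight theta y.
Proof.
by rewrite -big_split; apply: eq_bigr => i _; rewrite mxE mulrDr.
Qed.

Lemma weight0 theta : weight theta 0 = 0.
Proof. by apply: big1 => i _; rewrite mxE mulr0. Qed.

Lemma dimvec_ge0 V i : 0 <= dimvec V 0 i.
Proof. by rewrite mxE ler0n. Qed.

Lemma dimvec_neq0 V : dimvec V != 0 -> rep_nonzero V.
Proof.
move=> V0; apply: contrapT => Vz; case/eqP: V0; apply/rowP => i.
rewrite !mxE; apply/eqP; rewrite pnatr_eq0 dimv_eq0.
by apply: contra_notT Vz => Vi; exists i.
Qed.

Lemma sub_dimvec_ker_img V W (f : forall i, 'Hom(V i, W i)) :
  sub_dimvec (fun i => lker (f i)) + sub_dimvec (fun i => limg (f i)) =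
  dimvec V.
Proof.
by apply/rowP => i; rewrite !mxE -natrD -(limg_ker_dim (f i) fullv) capfv.
Qed.

Lemma subrep_ker V W (f : forall i, 'Hom(V i, W i)) :
  rep_hom f -> @subrep F k Q V (fun i => lker (f i)).
Proof.
move=> f_hom a; apply/subvP => _ /memv_imgP[v vK ->]; move: vK.
by rewrite !memv_ker f_hom => /eqP ->; rewrite linear0.
Qed.

Lemma subrep_img V W (f : forall i, 'Hom(V i, W i)) :
  rep_hom f -> @subrep F k Q W (fun i => limg (f i)).
Proof.
move=> f_hom a; apply/subvP => _ /memv_imgP[_ /memv_imgP[v _ ->] ->].
by rewrite -f_hom memv_img ?memvf.
Qed.

(** Schur's lemma: the weights of kernel and image add up to 0, while stability of [V] and [W]
    bounds each of them from below. *)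
Lemma stable_hom theta V W (f : forall i, 'Hom(V i, W i)) :
    stable theta V -> stable theta W -> rep_hom f ->
  (forall i, f i = 0) \/ (forall i, bijective (f i)).
Proof.
move=> [_ wV stV] [_ wW stW] f_hom.
have [K1|/existsNP[i /eqP Ki]] := pselect (forall i, lker (f i) = fullv).
  left=> i; apply/lfunP => v; rewrite lfunE /=; apply/eqP.
  by rewrite -memv_ker K1 memvf.
right; have wKL := congr1 (weight theta) (sub_dimvec_ker_img f).
rewrite weightD wV in wKL.
have L_neq0 : exists i, limg (f i) != 0%VS.
  by exists i; rewrite -lkerE; apply: contra Ki => ?; rewrite eqEsubv subvf.
(* If [f] is injective, its image is nonzero of weight 0, hence all of [W]. Otherwise the kernel is
   proper and nonzero, so its weight is positive, against a nonnegative weight of the image. *)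
have [K0|/existsNP[j /eqP Kj]] := pselect (forall i, lker (f i) = 0%VS).
  have wL : weight theta (sub_dimvec (fun i => limg (f i))) = 0.
    rewrite -[LHS]add0r -{}[RHS]wKL -[X in X + _](weight0 theta).
    by congr (weight _ _ + _); apply/rowP => j; rewrite !mxE K0 dimv0.
  have L1 j : limg (f j) = fullv.
    apply: contrapT => /eqP Lj; suff : 0 < 0 :> int by rewrite ltxx.
    by rewrite -[ltRHS]wL; apply/stW/(conj L_neq0); [exact: subrep_img | exists j].
  move=> j; have ker0 : lker (f j) == 0%VS by rewrite K0.
  exists (f j)^-1%VF; first exact: lker0_lfunK.
  by move=> v; rewrite limg_lfunVK // L1 memvf.
have wK : 0 < weight theta (sub_dimvec (fun i => lker (f i))).
  by apply: stV; [exact: subrep_ker | split; [exists j | exists i]].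
have wL : 0 <= weight theta (sub_dimvec (fun i => limg (f i))).
  have [L1|/existsNP[i' /eqP Li']] := pselect (forall i, limg (f i) = fullv).
    by rewrite -wW /dimvec /sub_dimvec; under eq_mx do rewrite -L1.
  by apply/ltW/stW; [exact: subrep_img | split=> //; exists i'].
by have := ltr_wpDr wL wK; rewrite wKL ltxx.
Qed.

Lemma ringel_le0 theta V W : stable theta V -> stable theta W ->
  ~ rep_iso V W -> ringel Q (dimvec V) (dimvec W) <= 0.
Proof.
move=> stV stW VW.
apply: (@ringel_le_dim_hom V W 0 (fun _ _ => 0)) => f f_hom.
have [f0|f_bij] := stable_hom stV stW f_hom; last by case: VW; exists f.
by exists (fun=> 0) => i; rewrite f0 big_ord0.
Qed.

Lemma semistable_weight_ge0 theta V (W : forall i, {vspace V i}) :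
  semistable theta V -> subrep W -> 0 <= weight theta (sub_dimvec W).
Proof.
move=> [wV ssV] subW.
have [W0|/existsNP[i /eqP Wi]] := pselect (forall i, W i = 0%VS).
  rewrite (_ : sub_dimvec W = 0) ?weight0 //.
  by apply/rowP => i; rewrite !mxE W0 dimv0.
have [W1|/existsNP[j /eqP Wj]] := pselect (forall i, W i = fullv).
  rewrite (_ : sub_dimvec W = dimvec V) ?wV //.
  by apply/rowP => j; rewrite !mxE W1.
by apply: ssV => //; split; [exists i | exists j].
Qed.

Section SubQuotient.
Variables (V : rep F Q) (W : forall i, {vspace V i}).
Hypothesis W_sub : subrep W.

Definition sub_rep : rep F Q :=
  @Rep F k Q (fun i => subvs_of (W i)) (fun a =>
    (linfun (vsproj (W (tgt a))) \o rmap V a \o linfun vsval)%VF).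

(* V / W, carried by the complements of the [W i]. *)
Definition quo_rep : rep F Q :=
  @Rep F k Q (fun i => subvs_of (W i)^C%VS) (fun a =>
    (linfun (vsproj (W (tgt a))^C) \o daddv_pi (W (tgt a))^C (W (tgt a))
       \o rmap V a \o linfun vsval)%VF).

Lemma dim_vsval_img (vT : vectType F) (X : {vspace vT})
    (U : {vspace subvs_of X}) :
  \dim (linfun vsval @: U)%VS = \dim U.
Proof.
apply: limg_dim_eq; apply/eqP; rewrite -subv0; apply/subvP => u.
rewrite memv_cap memv_ker lfunE /= => /andP[_ /eqP u0].
by rewrite memv0; apply/eqP/val_inj.
Qed.

Lemma dim_subvs_full (vT : vectType F) (X : {vspace vT}) :
  \dim {: subvs_of X} = \dim X.
Proof. exact: dimvf. Qed.

Lemma dimvec_sub_quo : dimvec sub_rep + dimvec quo_rep = dimvec V.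
Proof.
apply/rowP => i; rewrite !mxE /= -natrD !dim_subvs_full dimv_compl subnKC //.
by rewrite dimvS ?subvf.
Qed.

Lemma dimvec_sub : dimvec sub_rep = sub_dimvec W.
Proof. by apply/rowP => i; rewrite !mxE dim_subvs_full. Qed.

Lemma sub_rep_semistable theta : semistable theta V ->
  weight theta (sub_dimvec W) = 0 -> semistable theta sub_rep.
Proof.
move=> ssV wW; split=> [|U U_sub _]; first by rewrite dimvec_sub.
pose U' i := (linfun vsval @: U i)%VS : {vspace V i}.
have U'_sub : subrep U'.
  move=> a; apply/subvP => _ /memv_imgP[_ /memv_imgP[u uU ->] ->].
  have /subvP/(_ _ (memv_img _ uU)) := U_sub a.
  rewrite /= !comp_lfunE !lfunE /= => /(memv_img (linfun vsval)).
  rewrite lfunE /= vsprojK //; apply: (subvP (W_sub a)).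
  by rewrite memv_img ?subvsP.
have -> : sub_dimvec U = sub_dimvec U'.
  by apply/rowP => i; rewrite !mxE dim_vsval_img.
exact: semistable_weight_ge0.
Qed.

(** A subrepresentation of the quotient has a preimage in [V] of the same weight, because [W] has
    weight 0. *)
Lemma quo_rep_semistable theta : semistable theta V ->
  weight theta (sub_dimvec W) = 0 -> semistable theta quo_rep.
Proof.
move=> ssV wW; split=> [|U U_sub _].
  have := congr1 (weight theta) dimvec_sub_quo.
  by rewrite weightD dimvec_sub wW add0r ssV.1.
pose U' i := (W i + linfun vsval @: U i)%VS : {vspace V i}.
have capWC i : ((W i)^C :&: W i = 0)%VS by rewrite capvC capv_compl.
have U'_sub : subrep U'.
  move=> a; rewrite /U' limgD subv_add (subv_trans (W_sub a)) ?addvSl //=.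
  apply/subvP => _ /memv_imgP[_ /memv_imgP[u uU ->] ->].
  have /subvP/(_ _ (memv_img _ uU)) := U_sub a.
  rewrite /= !comp_lfunE !lfunE /= => /(memv_img (linfun vsval)).
  rewrite lfunE /= vsprojK ?memv_pi // => piU.
  (* The structure map of [quo_rep] keeps only the component of [v] in the complement; the discarded
     component lies in [W], so [v] still lies in [U']. *)
  set v := rmap V a _ in piU *.
  have v_full : v \in ((W (tgt a))^C + W (tgt a))%VS.
    by rewrite addvC addv_complf memvf.
  by rewrite -(daddv_pi_add (capWC _) v_full) addrC memv_add ?memv_pi.
have -> : weight theta (sub_dimvec U) = weight theta (sub_dimvec U').
  rewrite -[LHS]add0r -{}wW -weightD; congr weight; apply/rowP => i.
  rewrite !mxE -natrD -[in LHS]dim_vsval_img dimv_disjoint_sum //.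
  apply/eqP; rewrite -subv0 -(capWC i) capvC capvS //.
  by apply/subvP => _ /memv_imgP[u _ ->]; rewrite lfunE subvsP.
exact: semistable_weight_ge0.
Qed.

End SubQuotient.

(** A proper nonzero subrepresentation of weight 0 would split [dimvec V] into two nonzero
    semistable dimension vectors, those of [sub_rep] and [quo_rep]. *)
Lemma indecomposable_stable theta V : semistable theta V -> rep_nonzero V ->
    (forall x y, semistable_dimvec F Q theta x -> semistable_dimvec F Q theta y ->
       x + y = dimvec V -> x = 0 \/ y = 0) ->
  stable theta V.
Proof.
move=> ssV Vn0 V_atom; split=> //; first exact: ssV.1.
move=> W W_sub [[i Wi] [j Wj]]; rewrite lt_neqAle ssV.2 ?andbT //; last first.
  by split; [exists i | exists j].
apply/eqP => /esym wW.
case: (V_atom _ _ _ _ (dimvec_sub_quo W)).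
- by exists (sub_rep W); split=> //; exact: sub_rep_semistable.
- by exists (quo_rep W); split=> //; exact: quo_rep_semistable.
- move=> /rowP/(_ i); rewrite !mxE dim_subvs_full => /eqP.
  by rewrite pnatr_eq0 dimv_eq0 (negPf Wi).
move=> /rowP/(_ j); rewrite !mxE dim_subvs_full => /eqP.
rewrite pnatr_eq0 dimv_compl subn_eq0 => Vj.
by move: Wj; rewrite eqEdim subvf Vj.
Qed.

End Reps.

(** * Stable representations over an algebraically closed field *)

(** Every endomorphism is a scalar: subtracting an eigenvalue at one nonzero vertex space gives a
    non-bijective endomorphism, which vanishes by [stable_hom]. *)
Lemma ringel_le1 (F : closedFieldType) k (Q : quiver k) theta (V : rep F Q) :
  stable theta V -> ringel Q (dimvec V) (dimvec V) <= 1.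
Proof.
move=> stV.
apply: (@ringel_le_dim_hom F k Q V V 1 (fun _ _ => \1%VF)) => f f_hom.
have [[i Vi] _ _] := stV.
have [x fx] : exists x, ~ bijective (f i - x *: \1)%VF.
  pose A := f2mx (f i).
  (* The characteristic polynomial has size one more than the dimension of [V i], which is nonzero,
     so it is not constant. *)
  have /closed_rootP[x] : size (char_poly A) != 1%N.
    by rewrite size_char_poly eqSS -dimvf dimv_eq0.
  rewrite -eigenvalue_root_char => /eigenvalueP[v vA v0]; exists x => fx_bij.
  have fv : f i (r2v v) = x *: r2v v.
    by rewrite unlock /= r2vK vA linearZ.
  move/negP: v0; apply; apply/eqP/(can_inj r2vK)/(bij_inj fx_bij).
  by rewrite !linear0; do ![rewrite !lfunE /=]; rewrite fv subrr.
have fx_hom : rep_hom (fun j => f j - x *: \1)%VF.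
  by move=> a v; do ![rewrite !lfunE /=]; rewrite f_hom linearB !linearZ /= scalerN.
have [fx0|/(_ i) //] := stable_hom stV stV fx_hom.
by exists (fun=> x) => j; rewrite big_ord1; apply/eqP; rewrite -subr_eq0 fx0.
Qed.

Lemma stable_ext_ge0 (F : closedFieldType) k (Q : quiver k) theta m
    (S : 'I_m -> rep F Q) :
    (forall i, stable theta (S i)) ->
    (forall i j, rep_iso (S i) (S j) -> i = j) ->
  forall i j, 0 <= (i == j)%:R - ringel Q (dimvec (S i)) (dimvec (S j)).
Proof.
move=> stS isoS i j; rewrite subr_ge0.
have [<-|/eqP ij] := eqVneq i j; first exact: ringel_le1 (stS i).
by apply: (ringel_le0 (stS i) (stS j)) => /isoS.
Qed.

(** * Minimal generating sets of monoids of vectors *)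

Section MinimalGenerators.
Variables (k : nat) (A S : set 'rV[int]_k).
Hypothesis S_min : minimal_generators A S.

Lemma minimal_generators_sub g : S g -> A g.
Proof.
move=> Sg; rewrite -S_min.1; exists [:: g]; rewrite big_seq1; split=> // v.
by rewrite inE => /eqP ->.
Qed.

(** If [g] did not occur in [s], replacing each [g] by [s] would show that the set without [g] still
    generates, against minimality. *)
Lemma minimal_generator_sum g (s : seq 'rV[int]_k) : S g ->
  (forall v, v \in s -> S v) -> g = \sum_(v <- s) v -> g \in s.
Proof.
move=> Sg sS gE; apply/negP => /negP gs.
pose S' := S `\ g.
suff : monoid_span S' = A.
  move=> /(S_min.2 _ (@subDsetl _ _ _)) S'E.
  by have := Sg; rewrite -S'E => -[_ /=].
rewrite -S_min.1; apply/seteqP; split=> x [r [rS ->]].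
  by exists r; split=> // v /rS[].
exists (flatten [seq if v == g then s else [:: v] | v <- r]); split.
  move=> v /flatten_mapP[w wr]; case: eqP => [_ vs|wg].
    by split; [exact: sS | move=> /= vg; rewrite -vg vs in gs].
  by rewrite inE => /eqP ->; split=> //; exact: rS.
rewrite big_flatten big_map /=; apply: eq_bigr => v _.
by case: eqP => [-> //|_]; rewrite big_seq1.
Qed.

Hypothesis A_ge0 : forall x, A x -> forall i, 0 <= x 0 i.

Lemma minimal_generator_neq0 g : S g -> g != 0.
Proof.
move=> Sg; apply/eqP => g0.
(* Zero is the empty sum, so it would have to occur in the empty sequence. *)
suff : g \in [::] by [].
by apply: minimal_generator_sum => //; rewrite big_nil.
Qed.

(** Expanding [x] and [y] in generators, [g] itself must occur in one of the two sums; after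
    cancelling it, the remaining nonnegative vectors add up to 0. *)
Lemma minimal_generator_add g x y : S g -> A x -> A y -> x + y = g ->
  x = 0 \/ y = 0.
Proof.
wlog: x y / exists s t, [/\ forall v, v \in s -> S v, forall v, v \in t -> S v,
    x = \sum_(v <- s) v, y = \sum_(v <- t) v & g \in s].
  move=> IH Sg Ax Ay xyE; have := Ax; have := Ay; rewrite -{1 2}S_min.1.
  move=> [t [tS yE]] [s [sS xE]].
  have stS v : v \in s ++ t -> S v by rewrite mem_cat => /orP[/sS|/tS].
  have := minimal_generator_sum Sg stS; rewrite big_cat -xE -yE mem_cat.
  case/(_ (esym xyE))/orP => [gs|gt]; first by apply: IH => //; exists s, t.
  by case: (IH y x) => //; [exists t, s | rewrite addrC | right | left].
move=> [s [t [sS _ xE _ gs]]] Sg _ Ay xyE; right.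
have A_s v : v \in rem g s -> forall i, 0 <= v 0 i.
  by move=> /mem_rem/sS/minimal_generators_sub/A_ge0.
move: xyE; rewrite xE (perm_big _ (perm_to_rem gs)) big_cons -addrA.
rewrite -[RHS]addr0 => /addrI/rowP rest0; apply/rowP => i; move: (rest0 i).
rewrite !mxE summxE => /eqP; rewrite paddr_eq0 ?A_ge0 //.
  by case/andP => _ /eqP.
by rewrite big_seq sumr_ge0 // => v vs; exact: A_s.
Qed.

End MinimalGenerators.

(** * Stability of the generators and the theorem *)

Lemma minimal_generator_stable (F : fieldType) k (Q : quiver k) theta
    (S : set 'rV[int]_k) g :
    minimal_generators (semistable_dimvec F Q theta) S -> S g ->
  exists V : rep F Q, stable theta V /\ dimvec V = g.
Proof.
move=> S_min Sg; have [V [ssV Vg]] := minimal_generators_sub S_min Sg.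
have dim_ge0 x : semistable_dimvec F Q theta x -> forall i, 0 <= x 0 i.
  by move=> [W [_ <-]]; exact: dimvec_ge0.
exists V; split=> //; apply: indecomposable_stable => //.
  by apply: dimvec_neq0; rewrite Vg (minimal_generator_neq0 S_min).
by move=> x y Ax Ay; rewrite Vg; exact: (minimal_generator_add S_min).
Qed.

Lemma rep_iso_dimvec (F : fieldType) k (Q : quiver k) (V W : rep F Q) :
  rep_iso V W -> dimvec V = dimvec W.
Proof.
move=> [f [f_bij _]]; apply/rowP => i; rewrite !mxE; congr (_%:R).
have [h fK hK] := f_bij i.
rewrite -(limg_dim_eq (f := f i) (U := fullv)).
  congr (\dim _); apply/eqP; rewrite eqEsubv subvf.
  by apply/subvP => w _; rewrite -(hK w) memv_img ?memvf.
by apply/eqP; rewrite capfv; apply/lker0P/(can_inj fK).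
Qed.

Theorem theorem1 (R : realType) (k : nat) (Q : quiver k) (theta : 'rV[int]_k)
    (l : nat) (gam : 'I_l -> 'rV[int]_k)
    (gam_inj : injective gam)
    (gam_min : minimal_generators (semistable_dimvec R[i] Q theta) (range gam)) :
  let Qtheta := ext_quiver Q gam in
  [/\ forall i j : 'I_l,
        (narrows Qtheta i j)%:R = (i == j)%:R - ringel Q (gam i) (gam j) :> int,
      forall (N N' : rep R[i] Q) (c c' : 'rV[int]_l),
        stable theta N -> stable theta N' ->
        dimvec N = \sum_i c 0 i *: gam i ->
        dimvec N' = \sum_i c' 0 i *: gam i ->
        simple_dimvec R[i] Qtheta c -> simple_dimvec R[i] Qtheta c' ->
        ringel Q (dimvec N) (dimvec N') = ringel Qtheta c c' &
      forall (alpha : 'rV[int]_k) (M : moduli_point R[i] Q theta alpha)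
             (c : 'I_(nfactors M) -> 'rV[int]_l),
        (forall i : 'I_(nfactors M),
           dimvec (factor i) = \sum_j c i 0 j *: gam j) ->
        (forall i, simple_dimvec R[i] Qtheta (c i)) ->
        (forall i j : 'I_(nfactors M),
           (narrows (local_quiver M) i j)%:R
             = (i == j)%:R - ringel Qtheta (c i) (c j) :> int) /\
        local_setting M = (ext_quiver Qtheta c, mult_dimvec M)].
Proof.
move=> Qtheta.
have stable_gam i : exists V : rep R[i] Q, stable theta V /\ dimvec V = gam i.
  by apply: minimal_generator_stable gam_min _; exists i.
have [G G_spec] := choice stable_gam.
(* The stable representations [G i] realise the generators; they are pairwise non-isomorphic because
   their dimension vectors are distinct. *)
have gam_ge0 i j : 0 <= (i == j)%:R - ringel Q (gam i) (gam j).
  rewrite -(G_spec i).2 -(G_spec j).2.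
  apply: stable_ext_ge0 => [s|s t /rep_iso_dimvec]; first exact: (G_spec s).1.
  by rewrite (G_spec s).2 (G_spec t).2 => /gam_inj.
split.
- by move=> i j; rewrite narrows_quiver_of_counts natz gez0_abs.
- by move=> N N' c c' _ _ -> -> _ _; rewrite ringel_ext_quiver.
move=> alpha M c cE _.
have ringelM i j : ringel Q (dimvec (factor i)) (dimvec (factor j)) =
    ringel Qtheta (c i) (c j) by rewrite ringel_ext_quiver // -!cE.
split=> [i j|].
  rewrite narrows_quiver_of_counts natz gez0_abs ?ringelM // -ringelM.
  exact: (stable_ext_ge0 (@factor_stable _ _ _ _ _ M) (@factor_noniso _ _ _ _ _ M)).
(* Both quivers are built by [quiver_of_counts], so equal counts give equal quivers, not merely
   isomorphic ones. *)
congr pair; congr quiver_of_counts; apply/funext => i; apply/funext => j.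
by rewrite ringelM.
Qed.
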